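(* Let $(X,r)$ be a solution with Dehornoy class $m$. Then $m$ is the least common multiple of the orders of the generators $\sigma_x$, $x\in X$, in the abelian group $(\mathcal{G}(X,r),+)$. If moreover $(X,r)$ is indecomposable, then for every $x\in X$ the integer $m$ is the order of $\sigma_x$ in $(\mathcal{G}(X,r),+)$.
   Context: A solution $(X,r)$ is a non-empty finite set $X$, with $|X|>1$, together with an involutive map $r\colon X\times X\to X\times X$, $r(x,y)=(\sigma_x(y),\tau_y(x))$, satisfying $r_1r_2r_1=r_2r_1r_2$ on $X^3$, where $r_1=r\times \mathrm{Id}_X$ and $r_2=\mathrm{Id}_X\times r$, and such that all maps $\sigma_x$ and $\tau_x$ ($x\in X$) are bijections of $X$. Its permutation group $\mathcal{G}(X,r)$ is the group of permutations of $X$ generated by all $\sigma_x$, $x\in X$. A solution is decomposable if $X=Y\sqcup Z$ with $Y,Z$ non-empty and disjoint, $r(Y\times Y)=Y\times Y$ and $r(Z\times Z)=Z\times Z$ (equivalently, if $\mathcal{G}(X,r)$ is not transitive on $X$), and indecomposable otherwise. The diagonal map is the permutation $T(x)=\tau_x^{-1}(x)$ of $X$. The Dehornoy class of $(X,r)$ is the smallest positive integer $m$ such that $\sigma_{T^{m-1}(x)}\cdots\sigma_{T(x)}\sigma_x=\mathrm{Id}$ for all $x\in X$ (such an integer always exists). Brace structure on $\mathcal{G}(X,r)$: the structure group $G(X,r)=\langle X\mid xy=\sigma_x(y)\tau_y(x)\text{ for all }x,y\in X\rangle$ carries a commutative group operation $+$ satisfying $a(b+c)=ab-a+ac$, with $x+y=x\,\sigma_x^{-1}(y)$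 for $x,y\in X$, and such that $(G(X,r),+)$ is free abelian with basis $X$. The assignment $x\mapsto\sigma_x$ extends to a surjective group homomorphism $G(X,r)\to\mathcal{G}(X,r)$, and $\mathcal{G}(X,r)$ carries a unique operation $+$ for which this homomorphism is also additive. Then $(\mathcal{G}(X,r),+)$ is a finite abelian group, generated by the $\sigma_x$, $x\in X$, with neutral element $\mathrm{Id}$. *)

(* Defs.v *)
From HB Require Import structures.
From mathcomp Require Import all_boot all_order all_fingroup all_algebra.
From mathcomp Require Import generic_quotient boolp.

Set Implicit Arguments.
Unset Strict Implicit.
Unset Printing Implicit Defensive.

Import GRing.Theory.

Section BraidMaps.
Variables (X : Type) (r : X * X -> X * X).
Definition braid1 (p : X * X * X) : X * X * X := (r p.1, p.2).
Definition braid2 (p : X * X * X) : X * X * X :=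
  let q := r (p.1.2, p.2) in (p.1.1, q.1, q.2).
End BraidMaps.

Record solution := Solution {
  carrier :> finType;
  rmap : carrier * carrier -> carrier * carrier;
  carrier_gt1 : 1 < #|carrier|;
  rmapK : involutive rmap;
  rmap_braid : braid1 rmap \o braid2 rmap \o braid1 rmap
            =1 braid2 rmap \o braid1 rmap \o braid2 rmap;
  sigma_bij : forall x, bijective (fun y => (rmap (x, y)).1);
  tau_bij : forall y, bijective (fun x => (rmap (x, y)).2) }.

Section Solution.
Variable S : solution.

Definition sigma (x : S) : {perm S} := perm (bij_inj (sigma_bij x)).
Definition tau (y : S) : {perm S} := perm (bij_inj (tau_bij y)).

Definition decomposable : Prop :=
  exists Y Z : {set S},
    [/\ Y != set0 /\ Z != set0, [disjoint Y & Z], Y :|: Z = [set: S],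
        (@rmap S) @: setX Y Y = setX Y Y & (@rmap S) @: setX Z Z = setX Z Z].

Definition indecomposable : Prop := ~ decomposable.

Definition diagonal (x : S) : S := (tau x)^-1%g x.

(* In a product of permutations the leftmost factor is applied first, so this
   is the composite sigma_{T^(n-1)(x)} o ... o sigma_{T(x)} o sigma_x. *)
Definition dehornoy_prod (n : nat) (x : S) : {perm S} :=
  (\prod_(i < n) sigma (iter i diagonal x))%g.

Definition dehornoy_class (m : nat) : Prop :=
  [/\ 0 < m, forall x, dehornoy_prod m x = 1%g
    & forall n, 0 < n -> (forall x, dehornoy_prod n x = 1%g) -> m <= n].

Definition perm_group : {group {perm S}} := <<[set sigma x | x : S]>>%G.

Lemma sigma_in_perm_group (x : S) : sigma x \in perm_group.
Proof. exact/mem_gen/imset_f. Qed.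

Definition sigma_elt (x : S) : subg_of perm_group :=
  Subg (sigma_in_perm_group x).

(* The letter (x, false) stands for x and (x, true) for its inverse. *)
Definition letter := (S * bool)%type.
Definition invl (l : letter) : letter := (l.1, ~~ l.2).
Definition word := seq letter.

Inductive word_eq : word -> word -> Prop :=
| WRefl u : word_eq u u
| WSym u v : word_eq u v -> word_eq v u
| WTrans u v w : word_eq u v -> word_eq v w -> word_eq u w
| WCat u u' v v' : word_eq u u' -> word_eq v v' -> word_eq (u ++ v) (u' ++ v')
| WCancel l : word_eq [:: l; invl l] [::]
| WRel x y : word_eq [:: (x, false); (y, false)]
                     [:: (sigma x y, false); (tau y x, false)].

Definition word_eqb : rel word := fun u v => `[< word_eq u v >].

Lemma word_eqb_refl : reflexive word_eqb.
Proof. by move=> u; apply/asboolP; exact: WRefl. Qed.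
Lemma word_eqb_sym : symmetric word_eqb.
Proof. by move=> u v; apply/asboolP/asboolP => ?; exact: WSym. Qed.
Lemma word_eqb_trans : transitive word_eqb.
Proof.
by move=> v u w /asboolP uv /asboolP vw; apply/asboolP; exact: WTrans uv vw.
Qed.

Canonical word_equiv :=
  EquivRel word_eqb word_eqb_refl word_eqb_sym word_eqb_trans.

Definition structure_group : Type := {eq_quot word_equiv}%qT.
HB.instance Definition _ := Choice.on structure_group.
HB.instance Definition _ := EqQuotient.on structure_group.

Definition wclass (u : word) : structure_group := \pi_structure_group%qT u.

Lemma wclassP u v : wclass u = wclass v <-> word_eq u v.
Proof.
split=> [/eqquotP /asboolP //|uv]; apply/eqquotP; exact/asboolP.
Qed.

Lemma wclassK (a : structure_group) : wclass (repr a) = a.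
Proof. exact: reprK. Qed.

Lemma repr_wclass u : word_eq (repr (wclass u)) u.
Proof. by apply/wclassP; rewrite wclassK. Qed.

Definition winv (u : word) : word := rev (map invl u).

Lemma invlK : involutive invl.
Proof. by case=> x b; rewrite /invl /= negbK. Qed.

Lemma word_mulVw u : word_eq (winv u ++ u) [::].
Proof.
elim: u => [|l u IHu]; first exact: WRefl.
have -> : winv (l :: u) ++ l :: u = winv u ++ ([:: invl l; l] ++ u).
  by rewrite /winv /= rev_cons -cats1 -catA.
apply: (WTrans _ IHu); apply: WCat; first exact: WRefl.
rewrite -[X in word_eq _ X]cat0s; apply: WCat; last exact: WRefl.
by have := WCancel (invl l); rewrite invlK.
Qed.

Lemma winvK : involutive winv.
Proof. by move=> u; rewrite /winv map_rev revK mapK //; exact: invlK. Qed.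

Lemma word_mulwV u : word_eq (u ++ winv u) [::].
Proof. by have := word_mulVw (winv u); rewrite winvK. Qed.

Lemma winv_eq u v : word_eq u v -> word_eq (winv u) (winv v).
Proof.
move=> uv; apply: (@WTrans _ (winv u ++ v ++ winv v)).
  rewrite -[X in word_eq X _]cats0; apply: WCat; first exact: WRefl.
  exact/WSym/word_mulwV.
apply: (@WTrans _ (winv u ++ u ++ winv v)).
  apply: WCat; first exact: WRefl.
  by apply: WCat; [exact: WSym|exact: WRefl].
rewrite catA -[X in word_eq _ X]cat0s; apply: WCat; last exact: WRefl.
exact: word_mulVw.
Qed.

Definition sgmul (a b : structure_group) := wclass (repr a ++ repr b).
Definition sginv (a : structure_group) := wclass (winv (repr a)).

Lemma sgmulE u v : sgmul (wclass u) (wclass v) = wclass (u ++ v).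
Proof. by apply/wclassP; apply: WCat; exact: repr_wclass. Qed.

Lemma sginvE u : sginv (wclass u) = wclass (winv u).
Proof. by apply/wclassP; apply: winv_eq; exact: repr_wclass. Qed.

Lemma sgmulA : associative sgmul.
Proof.
by move=> a b c; rewrite -(wclassK a) -(wclassK b) -(wclassK c) !sgmulE catA.
Qed.
Lemma sgmul1g : left_id (wclass [::]) sgmul.
Proof. by move=> a; rewrite -(wclassK a) sgmulE. Qed.
Lemma sgmulg1 : right_id (wclass [::]) sgmul.
Proof. by move=> a; rewrite -(wclassK a) sgmulE cats0. Qed.
Lemma sgmulVg : left_inverse (wclass [::]) sginv sgmul.
Proof.
move=> a; rewrite -(wclassK a) sginvE sgmulE; exact/wclassP/word_mulVw.
Qed.
Lemma sgmulgV : right_inverse (wclass [::]) sginv sgmul.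
Proof.
move=> a; rewrite -(wclassK a) sginvE sgmulE; exact/wclassP/word_mulwV.
Qed.

HB.instance Definition _ :=
  isGroup.Build structure_group sgmulA sgmul1g sgmulg1 sgmulVg sgmulgV.

Definition structure_gen (x : S) : structure_group := wclass [:: (x, false)].

Lemma gen_rel (x y : S) :
  (structure_gen x * structure_gen y
     = structure_gen (sigma x y) * structure_gen (tau y x))%g.
Proof.
rewrite -[LHS]/(sgmul _ _) -[RHS]/(sgmul _ _) !sgmulE.
by apply/wclassP; exact: WRel.
Qed.

Definition letter_elt (l : letter) : subg_of perm_group :=
  if l.2 then ((sigma_elt l.1)^-1)%g else sigma_elt l.1.

(* The product of the permutation group is composition of functions, which is
   the opposite of the product of {perm S}: the word l1 l2 ... ln is sent to
   the permutation that applies ln first. *)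
Definition word_elt (w : word) : subg_of perm_group :=
  foldr (fun l p => p * letter_elt l)%g 1%g w.

Definition to_perm_group (a : structure_group) : subg_of perm_group :=
  word_elt (repr a).

Lemma word_elt_cat u v : word_elt (u ++ v) = (word_elt v * word_elt u)%g.
Proof.
by elim: u => [|l u IHu] /=; rewrite ?mulg1 // IHu mulgA.
Qed.

Lemma sigma_rel (x y : S) :
  (sigma y * sigma x = sigma (tau y x) * sigma (sigma x y))%g.
Proof.
apply/permP=> z; rewrite !permM !permE /=.
by have /(congr1 (fun p => p.1.1)) /= := rmap_braid (x, y, z).
Qed.

Lemma word_elt_eq u v : word_eq u v -> word_elt u = word_elt v.
Proof.
elim=> {u v} //=.
- by move=> u v w _ -> _ ->.
- by move=> u u' v v' _ IHu _ IHv; rewrite !word_elt_cat IHu IHv.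
- case=> x [] /=; rewrite mul1g /letter_elt /=; [exact: mulgV|exact: mulVg].
- by move=> x y; rewrite !mul1g; apply: val_inj; rewrite /= sigma_rel.
Qed.

Lemma to_perm_group_gen (x : S) :
  to_perm_group (structure_gen x) = sigma_elt x.
Proof.
by rewrite /to_perm_group (word_elt_eq (repr_wclass _)) /= mul1g.
Qed.

Lemma to_perm_groupM (a b : structure_group) :
  to_perm_group (a * b)%g = (to_perm_group b * to_perm_group a)%g.
Proof.
by rewrite /to_perm_group (word_elt_eq (repr_wclass _)) word_elt_cat.
Qed.

End Solution.

Record abelian_law (T : Type) := AbelianLaw {
  ab_add : T -> T -> T;
  ab_zero : T;
  ab_opp : T -> T;
  ab_addA : associative ab_add;
  ab_addC : commutative ab_add;
  ab_add0 : left_id ab_zero ab_add;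
  ab_addN : left_inverse ab_zero ab_opp ab_add }.

(* Copy of T whose algebraic structure is the law A, not the one T may have. *)
Definition additive_copy (T : Type) (A : abelian_law T) : Type := T.

HB.instance Definition _ (T : choiceType) (A : abelian_law T) :=
  Choice.copy (additive_copy A) T.
HB.instance Definition _ (T : choiceType) (A : abelian_law T) :=
  GRing.isZmodule.Build (additive_copy A)
    (ab_addA A) (ab_addC A) (ab_add0 A) (ab_addN A).
HB.instance Definition _ (T : finType) (A : abelian_law T) :=
  Finite.copy (additive_copy A) T.
HB.instance Definition _ (T : finType) (A : abelian_law T) :=
  [finGroupMixin of additive_copy A for +%R].

Definition add_order (T : finType) (A : abelian_law T) (x : T) : nat :=
  @order (additive_copy A) x.

Record is_structure_brace (S : solution)
    (A : abelian_law (structure_group S)) : Prop := IsStructureBrace {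
  brace_distr : forall a b c : structure_group S,
    (a * ab_add A b c)%g
      = ab_add A (ab_add A (a * b)%g (ab_opp A a)) (a * c)%g;
  brace_gen : forall x y : S,
    ab_add A (structure_gen x) (structure_gen y)
      = (structure_gen x * structure_gen ((sigma x)^-1 y))%g;
  brace_basis : forall a : additive_copy A,
    exists! c : {ffun S -> int},
      a = (\sum_x (structure_gen x : additive_copy A) *~ c x)%R }.

(* Main.v *)
Require Import Defs.
From mathcomp Require Import all_boot all_order all_fingroup all_algebra cyclic.

(** In any brace [x * (b + c) = x * b - x + x * c].  For generators [x], [y] of
    the structure group the rule [x + y = x * sigma_x^-1 y] reads
    [x * y = x + sigma_x y], and distributivity upgrades it by induction to
      [x * (n y) = x + n (sigma_x y)]              (lemma [gen_mul_multiple]).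
    Both claims follow from this one formula.

    - Take [y] with [sigma_x y = x].  Then [(n+1) x = x * (n y)], and [x] is the
      image of [y] under the diagonal map, since [r (x, y) = (x, y)].  Hence the
      multiple [n T^(n-1)(y)] is the product [T^(n-1)(y) ... T(y) y] of
      generators, and its image in the permutation group is the product which
      defines the Dehornoy class ([dehornoy_prod_multiple]).  The diagonal map
      is a bijection, so that product is trivial for every [y] exactly when [n]
      is a multiple of the additive order of every [sigma_x]
      ([dehornoy_prod_trivial]); the least such [n] is the least common multiple
      of the orders.

    - Mapping the formula to the permutation group shows that [n sigma_y]
      vanishes exactly when [n sigma_z] does, for [z = sigma_x y].  So the order
      of [sigma_y] is constant on orbits ([add_order_sigma]).  The level sets of
      a function invariant under all [sigma_x] split the solution, so in the
      indecomposable case that function is constant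
      ([indecomposable_invariant]). *)

Set Implicit Arguments.
Unset Strict Implicit.
Unset Printing Implicit Defensive.

Import GRing.Theory.

Definition multiple (T : choiceType) (A : abelian_law T) (n : nat) (x : T) : T :=
  ((x : additive_copy A) *+ n)%R.

Lemma multiple0 (T : choiceType) (A : abelian_law T) (x : T) :
  multiple A 0 x = ab_zero A.
Proof. by []. Qed.

Lemma multipleS (T : choiceType) (A : abelian_law T) (n : nat) (x : T) :
  multiple A n.+1 x = ab_add A x (multiple A n x).
Proof. exact: (@mulrS (additive_copy A) x n). Qed.

Lemma ab_addI (T : choiceType) (A : abelian_law T) (x : T) :
  injective (ab_add A x).
Proof. exact: (@addrI (additive_copy A) x). Qed.

Lemma dvdn_add_order (T : finType) (A : abelian_law T) (x : T) (n : nat) :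
  (add_order A x %| n) = (multiple A n x == ab_zero A).
Proof. exact: order_dvdn. Qed.

Section Solutions.
Variable S : solution.

(** This is the first component of [r (r (x, y)) = (x, y)]. *)
Lemma sigma_tau (x y : S) : sigma (sigma x y) (tau y x) = x.
Proof.
by rewrite !permE /=; have := rmapK (x, y); case: (rmap (x, y)) => a b /= ->.
Qed.

(** With [y = sigma_x^-1 x], the first component of [r (x, y)] is [x]; then
    [sigma_tau] makes the second one [y].  So [tau_y] sends [x] to [y], and the
    diagonal map sends [y] to [x]. *)
Lemma diagonal_sigmaV (x : S) : diagonal ((sigma x)^-1%g x) = x.
Proof.
set y := (sigma x)^-1%g x.
have sxy : sigma x y = x by rewrite /y permKV.
have tyx : tau y x = y.
  by apply: (@perm_inj _ (sigma x)); rewrite -{1}sxy sigma_tau.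
by rewrite /diagonal -{2}tyx permK.
Qed.

Lemma diagonal_inj : injective (@diagonal S).
Proof.
exact/(can_inj (g := fun x => (sigma x)^-1%g x))/canF_sym/diagonal_sigmaV.
Qed.

Lemma sigma_diagonalV (y : S) : (sigma (diagonal y))^-1%g (diagonal y) = y.
Proof. by apply: diagonal_inj; rewrite diagonal_sigmaV. Qed.

Lemma iter_diagonal_onto (n : nat) (x : S) : exists y, iter n (@diagonal S) y = x.
Proof.
elim: n x => [|n IHn] x; first by exists x.
have [y iter_y] := IHn ((sigma x)^-1%g x).
by exists y; rewrite iterS iter_y diagonal_sigmaV.
Qed.

(** A level set of [f] and its complement are both stable under the maps
    [sigma_x], hence under [r] because [tau_y x] is the preimage of [x] under
    one of the [sigma_z]. *)
Lemma indecomposable_invariant (V : eqType) (f : S -> V) :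
  indecomposable S -> (forall x y, f (sigma x y) = f y) ->
  forall x y, f x = f y.
Proof.
move=> indec f_sigma x y; apply/eqP/negPn/negP => fxy; apply: indec.
have stable (c : pred V) (Y := [set z | c (f z)]) :
    (@rmap S) @: setX Y Y = setX Y Y.
  have sub p : p \in setX Y Y -> rmap p \in setX Y Y.
    case: p => a b; rewrite !inE /= => /andP[ca cb].
    have -> : (rmap (a, b)).1 = sigma a b by rewrite permE.
    have -> : (rmap (a, b)).2 = tau b a by rewrite permE.
    by rewrite f_sigma cb -(f_sigma (sigma a b)) sigma_tau.
  apply/setP=> p; apply/imsetP/idP => [[q /sub rq ->] //|/sub rp].
  by exists (rmap p); rewrite ?rmapK.
exists [set z | f z == f x], [set z | f z != f x]; split.
- by split; apply/set0Pn; [exists x|exists y]; rewrite inE // eq_sym.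
- by rewrite disjoints_subset; apply/subsetP=> z; rewrite !inE negbK.
- by apply/setP=> z; rewrite !inE orbN.
- exact: (stable (fun v => v == f x)).
- exact: (stable (fun v => v != f x)).
Qed.

Variables (AG : abelian_law (structure_group S)).
Variables (AP : abelian_law (subg_of (perm_group S))).
Hypothesis brace : is_structure_brace AG.
Hypothesis pi_add :
  {morph @to_perm_group S : a b / ab_add AG a b >-> ab_add AP a b}.

Local Notation gen := (@structure_gen S).
Local Notation pi := (@to_perm_group S).

(** Distributivity applied to [1 * (0 + 0)] leaves [0 = 0 - 1 + 0], which
    forces the two neutral elements to coincide. *)
Lemma brace_zero : ab_zero AG = 1%g.
Proof.
have := brace_distr brace 1%g (ab_zero AG) (ab_zero AG).
rewrite (ab_add0 AG) !mul1g (ab_add0 AG) (ab_addC AG _ (ab_zero AG)) (ab_add0 AG).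
move=> /(congr1 (ab_add AG 1%g)).
rewrite (ab_addC AG _ (ab_opp _ _)) (ab_addN AG) (ab_addC AG) (ab_add0 AG).
by move=> ->.
Qed.

Lemma to_perm_group1 : pi 1%g = 1%g.
Proof.
by apply: (mulgI (pi 1%g)); rewrite -to_perm_groupM !mulg1.
Qed.

Lemma to_perm_group_zero : pi (ab_zero AG) = ab_zero AP.
Proof.
apply: (@ab_addI _ AP (pi (ab_zero AG))).
by rewrite -pi_add (ab_add0 AG) (ab_addC AP) (ab_add0 AP).
Qed.

Lemma perm_group_zero : ab_zero AP = 1%g.
Proof. by rewrite -to_perm_group_zero brace_zero to_perm_group1. Qed.

Lemma to_perm_group_multiple (n : nat) (x : S) :
  pi (multiple AG n (gen x)) = multiple AP n (sigma_elt x).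
Proof.
elim: n => [|n IHn]; first by rewrite !multiple0 to_perm_group_zero.
by rewrite !multipleS pi_add IHn to_perm_group_gen.
Qed.

(** This says that the additive map [b |-> - x + x * b] sends the generator
    [y] to the generator [sigma_x y]. *)
Lemma gen_mul_multiple (x y : S) (n : nat) :
  (gen x * multiple AG n (gen y))%g
    = ab_add AG (gen x) (multiple AG n (gen (sigma x y))).
Proof.
have gen_mul : (gen x * gen y)%g = ab_add AG (gen x) (gen (sigma x y)).
  by rewrite (brace_gen brace) permK.
elim: n => [|n IHn].
  by rewrite !multiple0 (ab_addC AG) (ab_add0 AG) brace_zero mulg1.
rewrite !multipleS (brace_distr brace) gen_mul IHn.
rewrite -!(ab_addA AG) (ab_addA AG (ab_opp _ _)) (ab_addN AG) (ab_add0 AG).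
by [].
Qed.

Lemma multiple_gen_diagonal (n : nat) (y : S) :
  multiple AG n.+1 (gen (diagonal y))
    = (gen (diagonal y) * multiple AG n (gen y))%g.
Proof.
rewrite multipleS gen_mul_multiple.
by rewrite -[X in sigma _ X](sigma_diagonalV y) permKV.
Qed.

(** The image of [(n+1) T(y) = T(y) * (n y)], unrolled.  The element
    whose multiple appears is the highest iterate [T^n(y)], the last factor of
    the product: that formula passes from [n y] to a multiple of [T(y)]. *)
Lemma dehornoy_prod_multiple (n : nat) (y : S) :
  dehornoy_prod n.+1 y
    = val (multiple AP n.+1 (sigma_elt (iter n (@diagonal S) y))).
Proof.
rewrite -to_perm_group_multiple; elim: n => [|n IHn].
  rewrite /dehornoy_prod big_ord1 /= multipleS multiple0.
  by rewrite (ab_addC AG) (ab_add0 AG) to_perm_group_gen.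
rewrite iterS multiple_gen_diagonal to_perm_groupM to_perm_group_gen /=.
by rewrite -IHn /dehornoy_prod big_ord_recr.
Qed.

(** Every [x] is the highest iterate [T^(n-1)(y)] for some [y], so the products
    for all [y] account for the multiples [n sigma_x] for all [x]. *)
Lemma dehornoy_prod_trivial (n : nat) : 0 < n ->
  (forall x : S, dehornoy_prod n x = 1%g)
    <-> \big[lcmn/1]_(x : S) add_order AP (sigma_elt x) %| n.
Proof.
case: n => // n _; split=> [prod1|/dvdn_biglcmP dvd_n y].
  apply/dvdn_biglcmP=> x _; rewrite dvdn_add_order perm_group_zero.
  have [y <-] := iter_diagonal_onto n x.
  by apply/eqP/val_inj; rewrite -dehornoy_prod_multiple prod1.
have := dvd_n (iter n (@diagonal S) y) isT.
by rewrite dvdn_add_order perm_group_zero dehornoy_prod_multiple => /eqP ->.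
Qed.

(** In the image of [x * (n y) = x + n (sigma_x y)], the left side is [sigma_x]
    exactly when [n sigma_y] vanishes, the right side exactly when the same
    multiple of the other permutation does. *)
Lemma add_order_sigma (x y : S) :
  add_order AP (sigma_elt (sigma x y)) = add_order AP (sigma_elt y).
Proof.
have pi_mul n : (multiple AP n (sigma_elt y) * sigma_elt x)%g
    = ab_add AP (sigma_elt x) (multiple AP n (sigma_elt (sigma x y))).
  rewrite -!to_perm_group_multiple -to_perm_group_gen -to_perm_groupM -pi_add.
  by rewrite gen_mul_multiple.
have dvd_eq n : (add_order AP (sigma_elt (sigma x y)) %| n)
    = (add_order AP (sigma_elt y) %| n).
  rewrite !dvdn_add_order -(inj_eq (@ab_addI _ AP (sigma_elt x))) -pi_mul.
  rewrite (ab_addC AP) (ab_add0 AP) -[X in _ == X]mul1g.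
  by rewrite (inj_eq (mulIg _)) perm_group_zero.
by apply/eqP; rewrite eqn_dvd dvd_eq dvdnn -dvd_eq dvdnn.
Qed.

End Solutions.

Theorem theorem7 (S : solution) (m : nat)
    (AG : abelian_law (structure_group S))
    (AP : abelian_law (subg_of (perm_group S))) :
  is_structure_brace AG ->
  {morph @to_perm_group S : a b / ab_add AG a b >-> ab_add AP a b} ->
  dehornoy_class S m ->
  m = \big[lcmn/1]_(x : S) add_order AP (sigma_elt x) /\
  (indecomposable S -> forall x : S, m = add_order AP (sigma_elt x)).
Proof.
move=> brace pi_add [m_gt0 m_triv m_min].
have trivP := dehornoy_prod_trivial brace pi_add.
have m_lcm : m = \big[lcmn/1]_(x : S) add_order AP (sigma_elt x).
  have lcm_dvd := (trivP m m_gt0).1 m_triv.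
  have lcm_gt0 := dvdn_gt0 m_gt0 lcm_dvd.
  apply/eqP; rewrite eqn_leq (dvdn_leq m_gt0 lcm_dvd) andbT.
  by apply: m_min => //; apply/trivP.
split=> // indec x.
have const y : add_order AP (sigma_elt y) = add_order AP (sigma_elt x).
  apply: (indecomposable_invariant (f := fun z => add_order AP (sigma_elt z))) => //.
  exact: add_order_sigma brace pi_add.
apply/eqP; rewrite eqn_dvd {1}m_lcm; apply/andP; split.
  by apply/dvdn_biglcmP=> y _; rewrite const.
by rewrite m_lcm; exact: biglcmn_sup (dvdnn _).
Qed.
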